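(* Let $\rho$ be a gauge, let $U\subseteq{}^{\rho}\widetilde{\mathbb{R}}^{n}$ be a sharply open set and $d\in\mathbb{N}$. Let $G$ be a set, let $q:\mathcal{M}_U^d\to G$ be a surjective map, and let $D^\alpha:G\to\mathbf{Set}(U,{}^{\rho}\widetilde{\mathbb{R}}^{d})$, $\alpha\in\mathbb{N}^n$, be maps such that $D^0:G\hookrightarrow\mathbf{Set}(U,{}^{\rho}\widetilde{\mathbb{R}}^{d})$ is the inclusion and $D^\alpha\circ q=\pi^\alpha$ for all $\alpha\in\mathbb{N}^n$. Then there exists one and only one map $\varphi:G\to{}^{\rho}\mathcal{GC}^\infty(U,{}^{\rho}\widetilde{\mathbb{R}}^{d})$ such that $\varphi\circ q=[-]_{\mathrm{f}}$ and which preserves derivatives, i.e. $\partial^\alpha\varphi(F)=D^\alpha F$ for all $F\in G$ and all $\alpha\in\mathbb{N}^n$.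
   Context: $I:=(0,1]$; elements of $X^I$ are called nets and written $(x_\varepsilon)$. A gauge is a net $\rho=(\rho_\varepsilon)\in\mathbb{R}_{>0}^I$ with $\rho_\varepsilon\to0$ as $\varepsilon\to0^+$. ''$\forall^0\varepsilon$'' means ''for all $\varepsilon\in I$ sufficiently small''. $\mathbb{N}=\{0,1,2,\dots\}$. $\mathbf{Set}(A,B)$ is the set of all functions from $A$ to $B$. $\mathbb{R}_\rho:=\{(x_\varepsilon)\in\mathbb{R}^I\mid\exists N\in\mathbb{N}:\ x_\varepsilon=O(\rho_\varepsilon^{-N})\text{ as }\varepsilon\to0^+\}$ is the ring of $\rho$-moderate nets; $(x_\varepsilon)\sim_\rho(y_\varepsilon)$ means $x_\varepsilon-y_\varepsilon=O(\rho_\varepsilon^{n})$ for all $n\in\mathbb{N}$; ${}^{\rho}\widetilde{\mathbb{R}}:=\mathbb{R}_\rho/\sim_\rho$, with classes denoted $[x_\varepsilon]$. For vector-valued nets, moderateness and equivalence classes are taken componentwise, so that points of ${}^{\rho}\widetilde{\mathbb{R}}^n$ are written $[x_\varepsilon]$ with $x_\varepsilon\in\mathbb{R}^n$. For $x,y\in{}^{\rho}\widetilde{\mathbb{R}}$, $x\le y$ means that for every representative $(x_\varepsilon)$ of $x$ there is a representative $(y_\varepsilon)$ of $y$ with $\forall^0\varepsilon:\ x_\varepsilon\le y_\varepsilon$; $x<y$ means $x\le y$ and $y-x$ is invertible. For $x=[x_\varepsilon]\in{}^{\rho}\widetilde{\mathbb{R}}^n$, $|x|:=[|x_\varepsilon|]\in{}^{\rho}\widetilde{\mathbb{R}}$.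 The sharp topology on ${}^{\rho}\widetilde{\mathbb{R}}^n$ is generated by the balls $B_r(x)=\{y\in{}^{\rho}\widetilde{\mathbb{R}}^n\mid|x-y|<r\}$ with $r\in{}^{\rho}\widetilde{\mathbb{R}}$, $r\ge0$ invertible; its open sets are called sharply open. Generalized smooth functions: for $X\subseteq{}^{\rho}\widetilde{\mathbb{R}}^n$ and $Y\subseteq{}^{\rho}\widetilde{\mathbb{R}}^d$, ${}^{\rho}\mathcal{GC}^\infty(X,Y)$ is the set of functions $f:X\to Y$ for which there is a net $(f_\varepsilon)\in\mathcal{C}^\infty(\mathbb{R}^n,\mathbb{R}^d)^I$ such that, for all $x\in X$ and all representatives $(x_\varepsilon)$ of $x$, $f(x)=[f_\varepsilon(x_\varepsilon)]$ and $(\partial^\alpha f_\varepsilon(x_\varepsilon))$ is $\rho$-moderate for all $\alpha\in\mathbb{N}^n$; one then says that $f$ is defined by $(f_\varepsilon)$ and writes $f=[f_\varepsilon(-)]$. $\mathcal{M}_U^d$ is the set of $(f_\varepsilon)\in\mathcal{C}^\infty(\mathbb{R}^n,\mathbb{R}^d)^I$ such that for all $[x_\varepsilon]\in U$ (all representatives) and all $\alpha\in\mathbb{N}^n$ the net $(\partial^\alpha f_\varepsilon(x_\varepsilon))$ is $\rho$-moderate. Define $[-]_{\mathrm{f}}:(f_\varepsilon)\in\mathcal{M}_U^d\mapsto[f_\varepsilon(-)]\in{}^{\rho}\mathcal{GC}^\infty(U,{}^{\rho}\widetilde{\mathbb{R}}^{d})$, and $\pi^\alpha:\mathcal{M}_U^d\to\mathbf{Set}(U,{}^{\rho}\widetilde{\mathbb{R}}^{d})$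 by $\pi^\alpha(f_\varepsilon):[x_\varepsilon]\in U\mapsto[\partial^\alpha f_\varepsilon(x_\varepsilon)]$. Derivatives: it is a known fact that for $U$ sharply open and $\alpha\in\mathbb{N}^n$ the map $\partial^\alpha:{}^{\rho}\mathcal{GC}^\infty(U,{}^{\rho}\widetilde{\mathbb{R}}^{d})\to{}^{\rho}\mathcal{GC}^\infty(U,{}^{\rho}\widetilde{\mathbb{R}}^{d})$, $[f_\varepsilon(-)]\mapsto[\partial^\alpha f_\varepsilon(-)]$, is well defined, i.e. independent of the net $(f_\varepsilon)$ defining the generalized smooth function (in particular $\pi^\alpha$ is well defined and $\partial^\alpha\circ[-]_{\mathrm{f}}=\pi^\alpha$). *)

(* Defs.v *)
From HB Require Import structures.
From mathcomp Require Import all_boot all_order all_algebra.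
From mathcomp Require Import all_classical all_reals all_analysis.
Import Order.TTheory GRing.Theory Num.Theory.
Import numFieldNormedType.Exports.

Set Implicit Arguments.
Unset Strict Implicit.
Unset Printing Implicit Defensive.

Local Open Scope classical_set_scope.
Local Open Scope ring_scope.
Local Open Scope quotient_scope.

Section Gauge.
Variable R : realType.

Definition netidx := {e : R | 0 < e <= 1}.

Fact netidx1 : 0 < (1 : R) <= 1. Proof. by rewrite ltr01 lexx. Qed.
HB.instance Definition _ := Choice.on netidx.
(* Pointedness is what makes netidx -> R a nontrivial ring, as required by
   the subring and quotient constructions below. *)
HB.instance Definition _ := isPointed.Build netidx (exist _ 1 netidx1).

(* [\forall e \near at0, P e] reads: P e holds for all sufficiently small e. *)
Definition at0 : set_system netidx :=
  filter_from [set: netidx] (fun e0 => [set e | val e <= val e0]).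

Global Instance at0_filter : ProperFilter at0.
Proof.
apply: filter_from_proper; last by move=> e _; exists e => /=.
apply: filter_from_filter; first by exists point.
move=> e1 e2 _ _; case: (leP (val e1) (val e2)) => h.
  by exists e1 => // e /= he; split => //; apply: le_trans h.
by exists e2 => // e /= he; split => //; apply: le_trans (ltW h).
Qed.
Canonical at0_filter_on := FilterType at0 at0_filter.

Record gauge := Gauge {
  gauge_val :> netidx -> R;
  gauge_gt0 : forall e, 0 < gauge_val e;
  gauge_cvg0 : gauge_val @ at0 --> 0 }.

End Gauge.
Arguments at0 {R}.

Section Ring.
Variables (R : realType) (rho : gauge R).
Notation I := (netidx R).

Definition moderate : {pred I -> R} :=
  [pred x | `[< exists N : nat, x =O_at0 (fun e => rho e ^- N) >]].

Definition negligible : {pred I -> R} :=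
  [pred x | `[< forall n : nat, x =O_at0 (fun e => rho e ^+ n) >]].

Lemma bigO_gt0P (x g : I -> R) : (forall e, 0 < g e) ->
  x =O_at0 g <->
  exists2 C, 0 < C & \forall e \near at0, `|x e| <= C * g e.
Proof.
move=> g0; split.
  move=> /eqO_exP [C C0 H]; exists C => //.
  by apply: filterS H => e; rewrite [`|g e|]gtr0_norm.
move=> [C C0 H]; apply/eqO_exP; exists C => //.
by apply: filterS H => e; rewrite [`|g e|]gtr0_norm.
Qed.

Lemma rho_gt0 n e : 0 < rho e ^+ n.
Proof. exact/exprn_gt0/gauge_gt0. Qed.

Lemma rhoV_gt0 n e : 0 < rho e ^- n.
Proof. by rewrite invr_gt0 rho_gt0. Qed.

Lemma moderateP (x : I -> R) : x \in moderate <->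
  exists N, exists2 C, 0 < C & \forall e \near at0, `|x e| <= C * rho e ^- N.
Proof.
split=> [/asboolP [N /bigO_gt0P]|[N /bigO_gt0P H]].
  by move=> /(_ (rhoV_gt0 N)); exists N.
by apply/asboolP; exists N; apply: H; apply: rhoV_gt0.
Qed.

Lemma negligibleP (x : I -> R) : x \in negligible <->
  forall n, exists2 C, 0 < C & \forall e \near at0, `|x e| <= C * rho e ^+ n.
Proof.
split=> [/asboolP H n|H]; first exact/(bigO_gt0P _ (rho_gt0 n)).
by apply/asboolP => n; apply/(bigO_gt0P _ (rho_gt0 n)).
Qed.

Lemma rho_le1 : \forall e \near at0, rho e <= 1.
Proof. exact: (cvgr_le 0 (@gauge_cvg0 _ rho)). Qed.

Lemma rhoV_le N M : (N <= M)%N ->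
  \forall e \near at0, rho e ^- N <= rho e ^- M.
Proof.
move=> NM; apply: filterS rho_le1 => e r1.
rewrite lef_pV2 ?posrE ?rho_gt0// ler_wiXn2l//.
exact/ltW/gauge_gt0.
Qed.

Fact moderate_subring : subring_closed moderate.
Proof.
split.
- apply/moderateP; exists 0%N; exists 1 => //.
  by apply: nearW => e /=; rewrite expr0 invr1 mulr1 [X in `|X|]/(1) normr1.
- move=> x y /moderateP [N [C C0 Hx]] /moderateP [M [D D0 Hy]].
  apply/moderateP; exists (N + M)%N; exists (C + D); first exact: addr_gt0.
  near=> e; rewrite [X in `|X|]/(x e - y e).
  apply: (le_trans (ler_normB _ _)); rewrite mulrDl lerD//.
    apply: (@le_trans _ _ (C * rho e ^- N)); first by near: e.
    by rewrite ler_pM2l//; near: e; apply: rhoV_le; rewrite leq_addr.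
  apply: (@le_trans _ _ (D * rho e ^- M)); first by near: e.
  by rewrite ler_pM2l//; near: e; apply: rhoV_le; rewrite leq_addl.
- move=> x y /moderateP [N [C C0 Hx]] /moderateP [M [D D0 Hy]].
  apply/moderateP; exists (N + M)%N; exists (C * D); first exact: mulr_gt0.
  near=> e; rewrite [X in `|X|]/(x e * y e) normrM exprD invfM mulrACA.
  by apply: ler_pM => //; near: e.
Unshelve. all: by end_near. Qed.
HB.instance Definition _ := GRing.isSubringClosed.Build _ moderate
  moderate_subring.

Record Rmod := ModerateNet { mod_val :> I -> R; mod_valP : mod_val \in moderate }.
HB.instance Definition _ := [isSub for mod_val].
HB.instance Definition _ := [Choice of Rmod by <:].
HB.instance Definition _ := [SubChoice_isSubComNzRing of Rmod by <:].

Definition negl : {pred Rmod} := [pred x : Rmod | mod_val x \in negligible].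

Lemma negligible0 : 0 \in negligible.
Proof.
apply/negligibleP => n; exists 1 => //; apply: nearW => e.
by rewrite [X in `|X|]/(0) normr0 mul1r ltW// rho_gt0.
Qed.

Lemma negligibleD x y : x \in negligible -> y \in negligible ->
  x + y \in negligible.
Proof.
move=> /negligibleP Hx /negligibleP Hy; apply/negligibleP => n.
have [C C0 {}Hx] := Hx n; have [D D0 {}Hy] := Hy n.
exists (C + D); first exact: addr_gt0.
near=> e; rewrite [X in `|X|]/(x e + y e).
by apply: (le_trans (ler_normD _ _)); rewrite mulrDl lerD//; near: e.
Unshelve. all: by end_near. Qed.

Lemma moderate_negligible x y : x \in moderate -> y \in negligible ->
  x * y \in negligible.
Proof.
move=> /moderateP [N [C C0 Hx]] /negligibleP Hy; apply/negligibleP => n.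
have [D D0 {}Hy] := Hy (n + N)%N.
exists (C * D); first exact: mulr_gt0.
near=> e; rewrite [X in `|X|]/(x e * y e) normrM.
have -> : C * D * rho e ^+ n = (C * rho e ^- N) * (D * rho e ^+ (n + N)).
  rewrite exprD mulrACA; congr (_ * _).
  by rewrite mulrCA mulVf ?mulr1// gt_eqF// rho_gt0.
by apply: ler_pM => //; near: e.
Unshelve. all: by end_near. Qed.

Lemma negligible_moderate x : x \in negligible -> x \in moderate.
Proof.
move=> /negligibleP /(_ 0%N) [C C0 H]; apply/moderateP; exists 0%N; exists C => //.
by apply: filterS H => e; rewrite !expr0 invr1.
Qed.

Lemma negligible1 : 1 \notin negligible.
Proof.
apply/negP => /negligibleP /(_ 1%N) [C C0 H].
have : \forall e \near @at0 R, False.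
  near=> e.
  have h1 : `|(1 : I -> R) e| <= C * rho e ^+ 1 by near: e.
  have : rho e < C^-1.
    near: e; apply: (cvgr_lt 0 (@gauge_cvg0 _ rho)).
    by rewrite invr_gt0.
  rewrite -(ltr_pM2l C0) mulfV ?gt_eqF// ltNge.
  by move: h1; rewrite [X in `|X|]/(1) normr1 expr1 => ->.
by case/filter_ex.
Unshelve. all: by end_near. Qed.

Fact negl_idealr : idealr_closed negl.
Proof.
split.
- exact: negligible0.
- exact: negligible1.
- move=> a u v hu hv.
  have -> : (a * u + v \in negl) = (mod_val a * mod_val u + mod_val v \in negligible) by [].
  by apply: negligibleD; [apply: moderate_negligible; [exact: mod_valP|]|].
Qed.
HB.instance Definition _ := isIdealr.Build _ negl negl_idealr.

(* Moderate nets modulo [negl]: x ~ y means x - y = O(rho^n) for all n. *)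
Definition Rtilde := {ideal_quot negl}.
HB.instance Definition _ := Choice.on Rtilde.
HB.instance Definition _ := GRing.ComNzRing.on Rtilde.
HB.instance Definition _ := EqQuotient.on Rtilde.
HB.instance Definition _ := isPointed.Build Rtilde 0.

(* The class [x_e]; total, with the junk value 0 on non-moderate nets. *)
Definition gclass (x : I -> R) : Rtilde := \pi_Rtilde (insubd (0 : Rmod) x).

Definition represents (x : I -> R) (p : Rtilde) : Prop :=
  x \in moderate /\ gclass x = p.

Definition grepr (p : Rtilde) : I -> R := mod_val (repr p).

Lemma grepr_represents p : represents (grepr p) p.
Proof. split; first exact: mod_valP. by rewrite /gclass valKd reprK. Qed.

Lemma eq_gclass x y : x \in moderate -> y \in moderate ->
  gclass x = gclass y <-> x - y \in negligible.
Proof.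
move=> mx my; rewrite /gclass.
have E : (x - y \in negligible) = (insubd (0 : Rmod) x - insubd 0 y \in negl).
  have -> : (insubd (0 : Rmod) x - insubd 0 y \in negl) =
    (mod_val (insubd 0 x) - mod_val (insubd 0 y) \in negligible) by [].
  by rewrite (insubdK _ mx) (insubdK _ my).
rewrite E; split; first by move/eqP; rewrite -Quotient.idealrBE.
by move=> h; apply/eqP; rewrite -Quotient.idealrBE.
Qed.
End Ring.

Section Smooth.
Variables (R : realType) (n d : nat).
Implicit Types f : 'rV[R]_n -> 'rV[R]_d.

Definition partial (i : 'I_n) f : 'rV[R]_n -> 'rV[R]_d :=
  fun x => 'D_(delta_mx 0 i) f x.

Definition iter_partial (s : seq 'I_n) f := foldr partial f s.

(* All iterated partial derivatives, in every order of differentiation, exist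
   and are continuous on the whole space. *)
Definition smooth f := forall s : seq 'I_n,
  continuous (iter_partial s f) /\
  forall i x, derivable (iter_partial s f) x (delta_mx 0 i).

(* d_0^(a 0) ... d_(n-1)^(a (n-1)) f, with d_(n-1) applied first. *)
Definition pderiv (a : {ffun 'I_n -> nat}) f :=
  foldr (fun i => iter (a i) (partial i)) f (enum 'I_n).

Definition word (a : {ffun 'I_n -> nat}) : seq 'I_n :=
  flatten [seq nseq (a i) i | i <- enum 'I_n].

Lemma iter_partial_cat s t f :
  iter_partial (s ++ t) f = iter_partial s (iter_partial t f).
Proof. exact: foldr_cat. Qed.

Lemma pderivE a f : pderiv a f = iter_partial (word a) f.
Proof.
rewrite /pderiv /word; elim: (enum _) => //= i s ->.
rewrite iter_partial_cat; elim: (a i) => //= k ->. by [].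
Qed.

Lemma smooth_iter s f : smooth f -> smooth (iter_partial s f).
Proof. by move=> sf t; rewrite -iter_partial_cat; apply: sf. Qed.

Lemma line_derive (F : 'rV[R]_n -> R) x v s : derivable F (x + s *: v) v ->
  is_derive (s : R) (1 : R) (fun t : R => F (x + t *: v)) ('D_v F (x + s *: v)).
Proof.
have E : (fun h : R => h^-1 *: (((fun t : R => F (x + t *: v)) \o shift s) (h *: (1 : R))
     - F (x + s *: v))) = (fun h : R => h^-1 *: ((F \o shift (x + s *: v)) (h *: v)
     - F (x + s *: v))).
  by apply/funext => h /=; congr (_ *: (F _ - _)); rewrite scalerDl addrCA [_%:A]mulr1.
by move=> dF; split; rewrite /derivable /derive E.
Qed.

Lemma MVT_line (F : 'rV[R]_n -> R) v (x : 'rV[R]_n) (t : R) :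
  (forall y, derivable F y v) ->
  exists2 c : R, `|c| <= `|t| & F (x + t *: v) - F x = 'D_v F (x + c *: v) * t.
Proof.
move=> dF.
pose g (s : R) := F (x + s *: v).
have dg s : is_derive (s : R) (1 : R) g ('D_v F (x + s *: v)) by exact: line_derive.
have cg (a b : R) : {within `[a, b], continuous g}.
  apply: continuous_subspaceT => z; apply: differentiable_continuous.
  by apply/derivable1_diffP; case: (dg z).
have [t0|t0] := leP 0 t.
  have [c] := MVT_segment t0 (fun s _ => dg s) (cg 0 t).
  rewrite in_itv/= subr0 /g scale0r addr0 => /andP[c0 ct] E.
  by exists c => //; rewrite !ger0_norm.
have [c] := MVT_segment (ltW t0) (fun s _ => dg s) (cg t 0).
rewrite in_itv/= /g scale0r addr0 sub0r => /andP[tc c0] E.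
exists c; first by rewrite !ler0_norm ?lerN2// ltW.
by rewrite -[LHS]opprB E mulrN opprK.
Qed.

Lemma coord_derivable f x v j : derivable f x v ->
  derivable (fun y => f y 0 j : R) x v.
Proof. by move=> /derivable_mxP; apply. Qed.

Lemma coord_derive f x v j : derivable f x v ->
  'D_v (fun y => f y 0 j : R) x = 'D_v f x 0 j.
Proof. by move=> df; rewrite derive_mx// mxE. Qed.

Lemma schwarz_coord (F : 'rV[R]_n -> R) u v x :
  (forall y, derivable F y u) -> (forall y, derivable F y v) ->
  (forall y, derivable ('D_u F) y v) -> (forall y, derivable ('D_v F) y u) ->
  continuous ('D_v ('D_u F)) -> continuous ('D_u ('D_v F)) ->
  'D_v ('D_u F) x = 'D_u ('D_v F) x.
Proof.
move=> Fu Fv Fuv Fvu cuv cvu.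
have key (w z : 'rV[R]_n) t : (forall y, derivable F y w) ->
    (forall y, derivable ('D_w F) y z) ->
    exists a b : R, [/\ `|a| <= `|t|, `|b| <= `|t| &
    F (x + t *: w + t *: z) - F (x + t *: z) - F (x + t *: w) + F x =
    'D_z ('D_w F) (x + a *: w + b *: z) * t ^+ 2].
  move=> Fw Fwz.
  pose G (y : 'rV[R]_n) := F (y + t *: z) - F y.
  have dsh y : derivable (fun y => F (y + t *: z)) y w /\
      'D_w (fun y => F (y + t *: z)) y = 'D_w F (y + t *: z).
    have E : (fun h : R => h^-1 *: (((fun y => F (y + t *: z)) \o shift y) (h *: w)
        - F (y + t *: z))) = (fun h : R => h^-1 *: ((F \o shift (y + t *: z)) (h *: w)
        - F (y + t *: z))).
      by apply/funext => h /=; rewrite addrA.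
    by rewrite /derivable /derive E; split => //; apply: Fw.
  have dG y : derivable G y w by apply: derivableB => //; case: (dsh y).
  have [a ha Ea] := MVT_line x t dG.
  have Eu : 'D_w G (x + a *: w) = 'D_w F (x + a *: w + t *: z) - 'D_w F (x + a *: w).
    by rewrite deriveB//; [case: (dsh (x + a *: w)) => _ ->|case: (dsh (x + a *: w))].
  have [b hb Eb] := MVT_line (x + a *: w) t Fwz.
  exists a, b; split => //.
  rewrite expr2 mulrA -Eb -Eu -Ea /G opprB addrA.
  by rewrite -!addrA; congr (_ + _); rewrite addrCA; congr (_ + _); rewrite addrC.
have tri (e p q r : R) : `|q - p| <= e / 2 -> `|r - p| <= e / 2 -> `|q - r| <= e.
  move=> h1 h2; rewrite [e]splitr -(subrKA p).
  by apply: (le_trans (ler_normD _ _)); apply: lerD => //; rewrite distrC.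
apply/eqP; rewrite -subr_eq0 -normr_le0; apply/ler_addgt0Pl => e e0; rewrite addr0.
have cv (w z : 'rV[R]_n) (H : 'rV[R]_n -> R) : continuous H ->
   exists2 r : R, 0 < r & forall a b : R, `|a| <= r -> `|b| <= r ->
     `|H x - H (x + a *: w + b *: z)| <= e / 2.
  move=> cH.
  have /cvgrPdist_le /(_ (e / 2)) := cH x.
  rewrite divr_gt0// => /(_ isT) /nbhs_normP [r /= r0 Hr].
  pose m := `|w| + `|z| + 1.
  have m0 : 0 < m by rewrite ltr_wpDl// addr_ge0.
  exists (r / 2 / m); first by rewrite !divr_gt0.
  move=> a b ha hb; apply: Hr => /=.
  rewrite -addrA opprD addNKr normrN.
  apply: (le_lt_trans (ler_normD _ _)); rewrite !normrZ.
  apply: (@le_lt_trans _ _ ((r / 2 / m) * m)).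
    rewrite /m mulrDr mulrDr mulr1 ler_wpDr//; first by rewrite !divr_ge0// ltW.
    by apply: lerD; apply: ler_wpM2r.
  by rewrite divfK ?gt_eqF// ltr_pdivrMr// ltr_pMr// ltr1n.
have [r1 r10 H1] := cv u v _ cuv.
have [r2 r20 H2] := cv v u _ cvu.
pose t := Num.min r1 r2.
have t0 : 0 < t by rewrite lt_min r10.
have [a [b [ha hb E1]]] := key u v t Fu Fuv.
have [a' [b' [ha' hb' E2]]] := key v u t Fv Fvu.
have tr1 : `|t| <= r1 by rewrite gtr0_norm// ge_min lexx.
have tr2 : `|t| <= r2 by rewrite gtr0_norm// ge_min lexx orbT.
have E : 'D_v ('D_u F) (x + a *: u + b *: v) = 'D_u ('D_v F) (x + a' *: v + b' *: u).
  apply: (@mulIf _ (t ^+ 2)); first by rewrite expf_neq0// gt_eqF.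
  by rewrite -[LHS]E1 -[RHS]E2 (addrAC x) (addrAC (F _)).
have K1 := H1 a b (le_trans ha tr1) (le_trans hb tr1).
have K2 := H2 a' b' (le_trans ha' tr2) (le_trans hb' tr2).
rewrite E in K1.
exact: tri K1 K2.
Qed.

Lemma partialC i j f : smooth f -> partial i (partial j f) = partial j (partial i f).
Proof.
move=> sf; apply/funext => x; apply/rowP => k.
have d0 l y : derivable f y (delta_mx 0 l) by have [_] := sf [::]; apply.
have d1 l m y : derivable (partial l f) y (delta_mx 0 m) by have [_] := sf [:: l]; apply.
have P1 l : (fun y => partial l f y 0 k) = 'D_(delta_mx 0 l) (fun y => f y 0 k).
  by apply/funext => y; rewrite coord_derive.
have P2 l m : (fun y => partial l (partial m f) y 0 k) =
    'D_(delta_mx 0 l) ('D_(delta_mx 0 m) (fun y => f y 0 k)).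
  by apply/funext => y; rewrite -P1 coord_derive.
have c2 l m : continuous (fun y => partial l (partial m f) y 0 k).
  move=> y; apply: (@continuous_comp _ _ _ (partial l (partial m f)) (fun M : 'rV[R]_d => M 0 k)).
    by have [+ _] := sf [:: l; m]; apply.
  exact: coord_continuous.
have Q l m : partial l (partial m f) x 0 k =
    'D_(delta_mx 0 l) ('D_(delta_mx 0 m) (fun y => f y 0 k)) x.
  exact: (congr1 (@^~ x) (P2 l m)).
apply: (eq_trans (Q i j)); apply/esym; apply: (eq_trans (Q j i)); apply/esym.
apply: schwarz_coord.
- by move=> y; exact: coord_derivable.
- by move=> y; exact: coord_derivable.
- by move=> y; rewrite -P1; exact: coord_derivable.
- by move=> y; rewrite -P1; exact: coord_derivable.
- by rewrite -P2; apply: c2.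
- by rewrite -P2; apply: c2.
Qed.

Lemma partial_iterC i s f : smooth f ->
  partial i (iter_partial s f) = iter_partial s (partial i f).
Proof.
move=> sf; elim: s => [//|j s IH].
apply: (eq_trans (partialC i j (smooth_iter s sf))).
exact: (congr1 (partial j) IH).
Qed.

Lemma iter_partialC s t f : smooth f ->
  iter_partial (s ++ t) f = iter_partial (t ++ s) f.
Proof.
elim: s => [|i s IH] sf; first by rewrite cats0.
apply: (eq_trans (congr1 (partial i) (IH sf))).
apply: (eq_trans (congr1 (partial i) (iter_partial_cat t s f))).
apply: (eq_trans (partial_iterC i t (smooth_iter s sf))).
exact: (esym (iter_partial_cat t (i :: s) f)).
Qed.

Lemma iter_partial_perm s t f : smooth f -> perm_eq s t ->
  iter_partial s f = iter_partial t f.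
Proof.
elim: s t => [|i s IH] t sf.
  by rewrite perm_sym => /perm_nilP ->.
move=> h; have it : i \in t by rewrite -(perm_mem h) mem_head.
case: (path.splitPr it) h => t1 t2.
rewrite perm_sym perm_catC /= perm_cons perm_sym => h.
apply: (eq_trans (congr1 (partial i) (IH _ sf h))).
exact: (iter_partialC (i :: t2) t1 sf).
Qed.

Lemma count_word a i : count_mem i (word a) = a i.
Proof.
rewrite /word count_flatten -map_comp.
rewrite (eq_map (g := fun j => (j == i) * a j)%N); last first.
  by move=> j /=; rewrite count_nseq /=.
rewrite sumnE big_map big_enum /= (bigD1 i)//= eqxx mul1n.
by rewrite big1 ?addn0// => j /negPf ->.
Qed.

Definition madd (a b : {ffun 'I_n -> nat}) : {ffun 'I_n -> nat} :=
  [ffun i => a i + b i]%N.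

Lemma pderivD a b f : smooth f -> pderiv a (pderiv b f) = pderiv (madd a b) f.
Proof.
move=> sf; rewrite !pderivE -iter_partial_cat; apply: iter_partial_perm => //.
by apply/allP => i _ /=; rewrite count_cat !count_word ffunE.
Qed.

Lemma smooth_pderiv a f : smooth f -> smooth (pderiv a f).
Proof. by move=> sf; rewrite pderivE; exact: smooth_iter. Qed.
End Smooth.

Section Points.
Variables (R : realType) (rho : gauge R).
Notation I := (netidx R).
Implicit Types x y : Rtilde rho.

Definition gle x y := forall xe, represents xe x ->
  exists2 ye, represents ye y & \forall e \near at0, xe e <= ye e.

Definition invertible x := exists y, x * y = 1.

Definition glt x y := gle x y /\ invertible (y - x).

Definition gpoint n := 'rV[Rtilde rho]_n.

Definition vmoderate n (x : I -> 'rV[R]_n) :=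
  forall i, (fun e => x e 0 i) \in moderate rho.

Definition vclass n (x : I -> 'rV[R]_n) : gpoint n :=
  \row_i gclass rho (fun e => x e 0 i).

Definition vrepresents n (x : I -> 'rV[R]_n) (p : gpoint n) :=
  forall i, represents (fun e => x e 0 i) (p 0 i).

Definition vrepr n (p : gpoint n) : I -> 'rV[R]_n :=
  fun e => \row_i grepr (p 0 i) e.

(* The library norm on 'rV[R]_n is the sup norm; |x| is the Euclidean one. *)
Definition enorm n (x : 'rV[R]_n) : R := Num.sqrt (\sum_i x 0 i ^+ 2).

(* |[x_e]| = [|x_e|], computed on a chosen representative; the class does not
   depend on it. *)
Definition gnorm n (p : gpoint n) : Rtilde rho :=
  gclass rho (fun e => enorm (vrepr p e)).

Definition gball n (p : gpoint n) (r : Rtilde rho) : set (gpoint n) :=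
  [set q | glt (gnorm (p - q : 'rV_n)) r].

HB.instance Definition _ n := Choice.on (gpoint n).
HB.instance Definition _ n := isPointed.Build (gpoint n) (0 : 'rV[Rtilde rho]_n).
(* The sharp topology: the balls with r >= 0 invertible form a subbase. *)
HB.instance Definition _ n := @isSubBaseTopological.Build (gpoint n)
  (gpoint n * Rtilde rho)%type
  [set pr | gle 0 pr.2 /\ invertible pr.2]
  (fun pr => gball pr.1 pr.2).

Lemma sharp_openE n (W : set (gpoint n)) : open W <->
  exists2 C, C `<=` finI_from
      [set pr : gpoint n * Rtilde rho | gle 0 pr.2 /\ invertible pr.2]
      (fun pr => gball pr.1 pr.2)
    & \bigcup_(A in C) A = W.
Proof. by []. Qed.

Lemma vclassE n (x : I -> 'rV[R]_n) p : vrepresents x p -> vclass x = p.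
Proof. by move=> xp; apply/rowP => i; rewrite mxE; case: (xp i). Qed.

Lemma vrepr_represents n (p : gpoint n) : vrepresents (vrepr p) p.
Proof.
move=> i; rewrite (_ : (fun e => vrepr p e 0 i) = grepr (p 0 i)).
  exact: grepr_represents.
by apply/funext => e; rewrite mxE.
Qed.

Lemma represents_sub x (xe ye : I -> R) : represents xe x -> represents ye x ->
  xe - ye \in negligible rho.
Proof. by move=> [mx <-] [my /esym E]; exact/(eq_gclass mx my). Qed.

Lemma represents_negl x (xe ye : I -> R) : represents xe x ->
  ye - xe \in negligible rho -> represents ye x.
Proof.
move=> [mx <-] H.
have my : ye \in moderate rho.
  by rewrite -[ye](subrK xe) rpredD// negligible_moderate.
by split => //; apply/(eq_gclass my mx).
Qed.
End Points.

Section GSF.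
Variables (R : realType) (rho : gauge R) (n d : nat).
Notation I := (netidx R).
Variable U : set (gpoint rho n).

Definition moderate_net (f : I -> 'rV[R]_n -> 'rV[R]_d) :=
  (forall e, smooth (f e)) /\
  forall (u : U) x, vrepresents x (val u) ->
    forall a, vmoderate rho (fun e => pderiv a (f e) (x e)).

Definition defines (f : I -> 'rV[R]_n -> 'rV[R]_d) (F : U -> gpoint rho d) :=
  (forall e, smooth (f e)) /\
  forall (u : U) x, vrepresents x (val u) ->
    F u = vclass rho (fun e => f e (x e)) /\
    forall a, vmoderate rho (fun e => pderiv a (f e) (x e)).

(* GC^oo(U, Rtilde^d); moderateness of f_e(x_e) itself is the case
   of the multi-index 0, so F u is never the junk value. *)
Definition GC := {F : U -> gpoint rho d | exists f, defines f F}.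

Definition MU := {f : I -> 'rV[R]_n -> 'rV[R]_d | moderate_net f}.

(* pi^a, evaluated on a chosen representative of each point. *)
Definition pi_net (a : {ffun 'I_n -> nat}) (f : MU) : U -> gpoint rho d :=
  fun u => vclass rho (fun e => pderiv a (sval f e) (vrepr (val u) e)).

Lemma pderiv0 (f : 'rV[R]_n -> 'rV[R]_d) : pderiv [ffun=> 0%N] f = f.
Proof. by rewrite /pderiv; elim: (enum 'I_n) => //= i s ->; rewrite ffunE. Qed.

Lemma pderiv_delta i (f : 'rV[R]_n -> 'rV[R]_d) : smooth f ->
  pderiv [ffun j => (j == i : nat)] f = partial i f.
Proof.
move=> sf; apply: (eq_trans (pderivE _ _)).
have h : perm_eq (word [ffun j => (j == i : nat)]) [:: i].
  by apply/allP => j _ /=; rewrite count_word ffunE addn0 (eq_sym i j).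
exact: (iter_partial_perm sf h).
Qed.

Lemma moderate_net_repr f : moderate_net f ->
  forall (u : U) x y, vrepresents x (val u) -> vrepresents y (val u) ->
  vclass rho (fun e => f e (x e)) = vclass rho (fun e => f e (y e)).
Proof.
move=> [sf mf] u x y xu yu.
have mf0 z : vrepresents z (val u) -> vmoderate rho (fun e => f e (z e)).
  move=> zu j; have := mf u z zu [ffun=> 0%N] j.
  by rewrite (_ : (fun e => pderiv _ _ _ _ _) = fun e => f e (z e) 0 j)//;
    apply/funext => e; rewrite pderiv0.
apply/rowP => j; rewrite !mxE.
pose z k e : 'rV[R]_n := \row_i (if (i < k)%N then y e 0 i else x e 0 i).
have zE k i : (fun e => z k e 0 i) =
    if (i < k)%N then (fun e => y e 0 i) else (fun e => x e 0 i).
  by apply/funext => e; rewrite mxE; case: ifP.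
have zu k : vrepresents (z k) (val u) by move=> i; rewrite zE; case: ifP.
suff H k : (k <= n)%N -> gclass rho (fun e => f e (x e) 0 j) =
    gclass rho (fun e => f e (z k e) 0 j).
  rewrite (H n)//; congr gclass; apply/funext => e; congr (f e _ 0 j).
  by apply/rowP => i; rewrite mxE ltn_ord.
elim: k => [_|k IH kn].
  by congr gclass; apply/funext => e; congr (f e _ 0 j); apply/rowP => i; rewrite mxE.
rewrite IH 1?ltnW//; pose i0 := Ordinal kn.
pose t e := y e 0 i0 - x e 0 i0.
have zS e : z k.+1 e = z k e + t e *: delta_mx 0 i0.
  apply/rowP => i; rewrite !mxE eqxx/= ltnS leq_eqVlt.
  have [->|ne] := eqVneq i i0; first by rewrite eqxx ltnn/= mulr1 /t subrKC.
  by rewrite mulr0 addr0 (negPf (ne : (i : nat) != k)).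
have dF e v : derivable (fun v => f e v 0 j : R) v (delta_mx 0 i0).
  by apply: coord_derivable; have [_] := sf e [::]; apply.
have /choice [c Hc] : forall e, exists c : R, `|c| <= `|t e| /\
    f e (z k.+1 e) 0 j - f e (z k e) 0 j =
    partial i0 (f e) (z k e + c *: delta_mx 0 i0) 0 j * t e.
  move=> e; have [c hc E] := MVT_line (z k e) (t e) (dF e).
  exists c; split => //; rewrite zS E coord_derive//.
  by have [_] := sf e [::]; apply.
pose w e := z k e + c e *: delta_mx 0 i0.
have tneg : t \in negligible rho by apply: (represents_sub (yu i0) (xu i0)).
have wu : vrepresents w (val u).
  move=> i; apply: (represents_negl (zu k i)).
  apply/negligibleP => m; move/negligibleP: tneg => /(_ m) [C C0 HC].
  exists C => //; apply: filterS HC => e; apply: le_trans.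
  have E : w e 0 i - z k e 0 i = c e * (i == i0)%:R.
    by rewrite /w; move: (z k e) => v; rewrite !mxE eqxx/= addrC addKr.
  apply: (@le_trans _ _ `|c e * (i == i0)%:R|); first by rewrite -E.
  apply: le_trans (proj1 (Hc e)); rewrite normrM ler_piMr//.
  by case: eqP; rewrite ?normr1 ?normr0.
apply/esym/eq_gclass; [exact: mf0|exact: mf0|].
have -> : ((fun e => f e (z k.+1 e) 0 j) - (fun e => f e (z k e) 0 j)) =
    (fun e => partial i0 (f e) (w e) 0 j) * t.
  by apply/funext => e; exact: (proj2 (Hc e)).
apply: moderate_negligible => //.
have := mf u w wu [ffun i => (i == i0 : nat)] j.
by rewrite (_ : (fun e => pderiv _ _ _ _ _) = fun e => partial i0 (f e) (w e) 0 j)//;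
    apply/funext => e; rewrite pderiv_delta.
Qed.

Fact gsf_subproof (f : MU) : exists g,
  defines g (fun u => vclass rho (fun e => sval f e (vrepr (val u) e))).
Proof.
exists (sval f); have [sf mf] := svalP f; split=> // u x xu; split; last exact: mf.
by apply: (moderate_net_repr (svalP f)) => //; apply: vrepr_represents.
Qed.

(* [-]_f; the subproof shows that f_e(x_e) may be computed on any
   representative. *)
Definition gsf (f : MU) : GC := exist _ _ (gsf_subproof f).

Fact pderiv_net_subproof a (f : MU) : moderate_net (fun e => pderiv a (sval f e)).
Proof.
have [sf mf] := svalP f; split; first by move=> e; exact/smooth_pderiv/sf.
move=> u x xu b j.
have := mf u x xu (madd b a) j.
by rewrite (_ : (fun e => pderiv (madd b a) _ _ _ _) =
  fun e => pderiv b (pderiv a (sval f e)) (x e) 0 j)//; apply/funext => e; rewrite pderivD.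
Qed.

Definition pderiv_net a (f : MU) : MU := exist _ _ (pderiv_net_subproof a f).

Fact defining_net_subproof (F : GC) : moderate_net (projT1 (cid (svalP F))).
Proof.
have [sf Hf] := projT2 (cid (svalP F)).
by split => // u x xu; case: (Hf u x xu).
Qed.

Definition defining_net (F : GC) : MU := exist _ _ (defining_net_subproof F).

(* d^a [f_e(-)] = [d^a f_e(-)] for a chosen defining net; when U is sharply
   open the result does not depend on that choice. *)
Definition gderiv a (F : GC) : GC := gsf (pderiv_net a (defining_net F)).

End GSF.

(* Main.v *)
(* Since D^0 is the inclusion, F = q(f_e) is the function [f_e(-)], so phi must
   send F to [f_e(-)]; derivatives are preserved because d^a [f_e(-)] does not
   depend on the defining net. By induction on the order of differentiation this
   reduces to one partial derivative of a net H_e vanishing on U: sharp openness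
   puts the segments x + c delta_i, |c| <= rho^m, inside U, and the mean value
   theorem interpolates D H between H and D^2 H (Landau's inequality). *)

Require Import Defs.
From mathcomp Require Import all_boot all_order all_algebra.
From mathcomp Require Import all_classical all_reals all_analysis.
From mathcomp Require Import finmap ring lra.
Import Order.TTheory GRing.Theory Num.Theory.
Import numFieldNormedType.Exports.
(* Imported again: [negligible] must mean negligible nets, not null sets. *)
Import Defs.

Set Implicit Arguments.
Unset Strict Implicit.
Unset Printing Implicit Defensive.

Local Open Scope classical_set_scope.
Local Open Scope ring_scope.

(** * Asymptotics of nets; order and invertibility read off from representatives *)

Section Nets.
Variables (R : realType) (rho : gauge R).
Notation I := (netidx R).

Lemma rho_le (c : R) : 0 < c -> \forall e \near at0, rho e <= c.
Proof. exact: (cvgr_le 0 (@gauge_cvg0 _ rho)). Qed.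

Lemma rhoX_le N M : (N <= M)%N -> \forall e \near at0, rho e ^+ M <= rho e ^+ N.
Proof.
move=> NM; apply: filterS (@rho_le1 _ rho) => e r1.
by rewrite ler_wiXn2l//; apply/ltW/gauge_gt0.
Qed.

Lemma moderate_le (x y : I -> R) : x \in moderate rho ->
  (\forall e \near at0, `|y e| <= `|x e|) -> y \in moderate rho.
Proof.
move=> /moderateP[N [C C0 Hx]] Hy; apply/moderateP; exists N, C => //.
by near=> e; apply: (@le_trans _ _ `|x e|); near: e.
Unshelve. all: by end_near. Qed.

Lemma negligible_le (x y : I -> R) : x \in negligible rho ->
  (\forall e \near at0, `|y e| <= `|x e|) -> y \in negligible rho.
Proof.
move=> /negligibleP Hx Hy; apply/negligibleP => m.
have [C C0 {}Hx] := Hx m; exists C => //.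
by near=> e; apply: (@le_trans _ _ `|x e|); near: e.
Unshelve. all: by end_near. Qed.

Lemma negligibleB (x y : I -> R) : x \in negligible rho -> y \in negligible rho ->
  x - y \in negligible rho.
Proof.
move=> hx hy; apply: negligibleD => //; apply: negligible_le hy _.
by apply: nearW => e; rewrite [X in `|X|]/(- y e) normrN.
Qed.

Lemma rhoX_moderate m : (fun e => rho e ^+ m) \in moderate rho.
Proof.
apply/moderateP; exists 0%N, 1 => //; apply: filterS (@rho_le1 _ rho) => e r1.
have r0 := ltW (gauge_gt0 rho e).
by rewrite expr0 invr1 mulr1 ger0_norm ?exprn_ge0// exprn_ile1.
Qed.

Lemma represents_gclass (x : I -> R) : x \in moderate rho ->
  represents x (gclass rho x).
Proof. by []. Qed.

Lemma representsM (x y : I -> R) (p q : Rtilde rho) :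
  represents x p -> represents y q -> represents (x * y) (p * q).
Proof.
move=> [mx <-] [my <-]; split; first exact: rpredM.
rewrite /gclass.
have -> : insubd (0 : Rmod rho) (x * y) = insubd 0 x * insubd 0 y.
  by apply: val_inj; rewrite /= !insubdK// rpredM.
exact: rmorphM.
Qed.

Lemma representsB (x y : I -> R) (p q : Rtilde rho) :
  represents x p -> represents y q -> represents (x - y) (p - q).
Proof.
move=> [mx <-] [my <-]; split; first exact: rpredB.
rewrite /gclass.
have -> : insubd (0 : Rmod rho) (x - y) = insubd 0 x - insubd 0 y.
  by apply: val_inj; rewrite /= !insubdK// rpredB.
exact: rmorphB.
Qed.

Lemma represents1 : represents (1 : I -> R) (1 : Rtilde rho).
Proof.
split; first exact: rpred1.
rewrite /gclass.
have -> : insubd (0 : Rmod rho) 1 = 1.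
  by apply: val_inj; rewrite /= insubdK// rpred1.
exact: rmorph1.
Qed.

(** One pair of representatives suffices: another representative [z] of [p] differs from [x] by a
    negligible net, and adding [z - x] to [y] changes only the representative of [q]. *)
Lemma represents_gle (x y : I -> R) (p q : Rtilde rho) :
  represents x p -> represents y q ->
  (\forall e \near at0, x e <= y e) -> gle p q.
Proof.
move=> xp yq xy z zp; exists (y + (z - x)).
  by apply: (represents_negl yq); rewrite addrC addKr; apply: represents_sub zp xp.
apply: filterS xy => e xy; change (z e <= y e + (z e - x e)).
by rewrite addrC -addrA lerDl addrC subr_ge0.
Qed.

(** If [y] represents the inverse, then [x * y] is within 1/2 of 1 for small [e], so [x] is at least
    1/2 divided by the moderate bound on [y]. *)
Lemma invertible_lb (x : I -> R) (p : Rtilde rho) : represents x p ->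
  invertible p -> exists N, \forall e \near at0, rho e ^+ N <= `|x e|.
Proof.
move=> xp [s ps1]; have sr := grepr_represents s; set y := grepr s in sr.
have := representsM xp sr; rewrite ps1 => /represents_sub/(_ represents1).
move=> /negligibleP/(_ 1%N)[C C0 HC].
have [/moderateP[N [K K0 HK]] _] := sr.
(* With [|y e| <= K * rho e ^- N], the extra factor [rho e] absorbs the constant [2 * K]. *)
exists N.+1; near=> e.
have rN := rho_gt0 rho N e.
have h1 : `|x e * y e - 1| <= 2^-1.
  apply: (@le_trans _ _ (C * rho e ^+ 1)); first by near: e.
  rewrite expr1 mulrC -ler_pdivlMr//; near: e; apply: rho_le.
  by rewrite divr_gt0// invr_gt0.
have h2 : `|y e| <= K * rho e ^- N by near: e.
have h3 : 2^-1 <= `|x e * y e|.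
  have : (1 : R) <= `|x e * y e| + `|x e * y e - 1|.
    rewrite -{1}[1]normr1 -{1}(subKr (x e * y e) 1).
    exact: ler_normB.
  by move: h1; lra.
have h4 : rho e <= (2 * K)^-1.
  by near: e; apply: rho_le; rewrite invr_gt0 mulr_gt0.
have : 2^-1 <= `|x e| * (K * rho e ^- N).
  by apply: (le_trans h3); rewrite normrM ler_wpM2l.
rewrite mulrA ler_pdivlMr// -ler_pdivrMr// => h5.
apply: le_trans h5; rewrite exprS ler_pdivlMr//.
rewrite mulrAC ler_wpM2r ?(ltW rN)// -ler_pdivlMr//.
by rewrite -invfM.
Unshelve. all: by end_near. Qed.

(** The pointwise inverse is moderate by the lower bound, and [x * y - 1] vanishes exactly for small
    [e]; zeros of [x] at larger [e] are harmless. *)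
Lemma lb_invertible (x : I -> R) (p : Rtilde rho) N : represents x p ->
  (\forall e \near at0, rho e ^+ N <= x e) -> invertible p.
Proof.
move=> xp hx; pose y e := (x e)^-1.
have my : y \in moderate rho.
  apply/moderateP; exists N, 1 => //; apply: filterS hx => e hx.
  have x0 : 0 < x e := lt_le_trans (rho_gt0 rho N e) hx.
  rewrite mul1r /y /= ger0_norm ?invr_ge0 ?(ltW x0)// lef_pV2 ?posrE//.
  exact: rho_gt0.
exists (gclass rho y).
have := representsM xp (represents_gclass my) => - [_ <-].
have [_ <-] := represents1; apply/eq_gclass.
- by apply: rpredM => //; case: xp.
- exact: rpred1.
- apply: negligible_le (negligible0 rho) _; apply: filterS hx => e hx.
  have xe0 : x e != 0 by rewrite gt_eqF// (lt_le_trans (rho_gt0 rho N e)).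
  have E : x e / x e - 1 = 0 by rewrite divff// subrr.
  by rewrite (_ : (x * y - 1) e = 0) ?normr0//; exact: E.
Qed.
End Nets.

(** * Lipschitz bound for the Euclidean norm in the l1 distance *)

Section EuclideanNorm.
Variables (R : realType) (n : nat).

(** Compare squares: expand each [x 0 i ^+ 2] around [y 0 i], bound [|y 0 i|] by [S] and one factor
    of the squared difference by [D]; the sum is [S ^+ 2 + (2 * S + D) * D = (S + D) ^+ 2]. *)
Lemma enorm_le_sum (x y : 'rV[R]_n) :
  enorm x <= enorm y + \sum_i `|x 0 i - y 0 i|.
Proof.
set D := \sum_i _; set S := enorm y.
have D0 : 0 <= D by apply: sumr_ge0.
have S0 : 0 <= S by apply: sqrtr_ge0.
have SE : S ^+ 2 = \sum_i y 0 i ^+ 2.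
  by rewrite sqr_sqrtr// sumr_ge0// => i _; rewrite sqr_ge0.
have yS i : `|y 0 i| <= S.
  rewrite -sqrtr_sqr ler_wsqrtr// (bigD1 i)//= lerDl sumr_ge0// => j _.
  exact: sqr_ge0.
have dD i : `|x 0 i - y 0 i| <= D by rewrite /D (bigD1 i)//= lerDl sumr_ge0.
rewrite -(ger0_norm (addr_ge0 S0 D0)) -sqrtr_sqr ler_wsqrtr//.
have -> : (S + D) ^+ 2 = \sum_i (y 0 i ^+ 2 + (2 * S + D) * `|x 0 i - y 0 i|).
  by rewrite big_split/= -mulr_sumr -SE -/D; ring.
apply: ler_sum => i _.
have -> : x 0 i ^+ 2 =
    y 0 i ^+ 2 + (2 * y 0 i * (x 0 i - y 0 i) + (x 0 i - y 0 i) ^+ 2) by ring.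
rewrite lerD2l [leRHS]mulrDl lerD//.
  apply: (le_trans (ler_norm _)).
  by rewrite !normrM (ger0_norm (ler0n _ 2)) ler_wpM2r// ler_wpM2l.
by rewrite -real_normK ?num_real// expr2 ler_wpM2r.
Qed.

Lemma enorm_lip (x y : 'rV[R]_n) :
  `|enorm x - enorm y| <= \sum_i `|x 0 i - y 0 i|.
Proof.
rewrite ler_norml; have h1 := enorm_le_sum x y; have := enorm_le_sum y x.
by under eq_bigr do rewrite distrC; lra.
Qed.

Lemma enorm0 : enorm (0 : 'rV[R]_n) = 0.
Proof.
by rewrite /enorm big1 ?sqrtr0// => i _; rewrite mxE expr0n.
Qed.
End EuclideanNorm.

(** * Sharp neighbourhoods in terms of representatives *)

Section SharpTopology.
Variables (R : realType) (rho : gauge R) (n : nat).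
Notation I := (netidx R).
Implicit Types (x y : I -> 'rV[R]_n) (p q : gpoint rho n).

(** Frees [gnorm] from its chosen representative: the Lipschitz bound against 0 gives moderateness,
    and against another representative a negligible difference. *)
Lemma gnorm_represents x p : vrepresents x p ->
  represents (fun e => enorm (x e)) (gnorm p).
Proof.
move=> xp; rewrite /gnorm; have := vrepr_represents p; move: (vrepr p) => v vp.
have mv : (fun e => enorm (v e)) \in moderate rho.
  have : \sum_i (fun e => `|v e 0 i|) \in moderate rho.
    apply: rpred_sum => i _; have [mvi _] := vp i.
    by apply: moderate_le mvi _; apply: nearW => e; rewrite normr_id.
  move=> /moderate_le; apply; apply: nearW => e; rewrite fct_sumE.
  rewrite [leRHS]ger0_norm ?sumr_ge0//.
  have := enorm_lip (v e) 0; rewrite enorm0 subr0 => /le_trans; apply.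
  by apply: ler_sum => i _; rewrite mxE subr0.
apply: represents_negl (represents_gclass mv) _.
have : \sum_i (fun e => `|x e 0 i - v e 0 i|) \in negligible rho.
  elim/big_ind: _ => [||i _]; [exact: negligible0|exact: negligibleD|].
  apply: negligible_le (represents_sub (xp i) (vp i)) _.
  by apply: nearW => e; rewrite normr_id.
move=> /negligible_le; apply; apply: nearW => e; rewrite fct_sumE.
by rewrite [leRHS]ger0_norm ?sumr_ge0//; exact: enorm_lip.
Qed.

Lemma vrepresentsB x y p q : vrepresents x p -> vrepresents y q ->
  vrepresents (fun e => x e - y e) (p - q : 'rV_n).
Proof.
move=> xp yq i; have := representsB (xp i) (yq i); rewrite !mxE.
by congr represents; apply/funext => e; rewrite !mxE.
Qed.

(** The gap between the radius and the distance to the centre is invertible and nonnegative, hence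
    at least [rho e ^+ N] for small [e], and a small enough displacement cannot close it. *)
Lemma gball_interior p r q x : gball p r q -> vrepresents x q ->
  exists m, forall y q', vrepresents y q' ->
    (forall i, \forall e \near at0, `|y e 0 i - x e 0 i| <= rho e ^+ m) ->
    gball p r q'.
Proof.
move=> [qr inv] xq; have := vrepr_represents p; move: (vrepr p) => v vp.
have ar := gnorm_represents (vrepresentsB vp xq).
have [s sr les] := qr _ ar.
have [N HN] := invertible_lb (representsB sr ar) inv.
(* Displacing [n] coordinates costs at most [n] times [rho e ^+ N.+1]; once [rho e <= (n.+1%:R)^-1],
   a gap of [rho e ^+ N.+1] survives, which keeps the inequality strict. *)
exists N.+1 => y q' yq' xy.
have br := gnorm_represents (vrepresentsB vp yq').
have key : \forall e \near at0, rho e ^+ N.+1 <= s e - enorm (v e - y e).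
  near=> e.
  have h1 : rho e ^+ N <= `|s e - enorm (v e - x e)| by near: e.
  have h2 : enorm (v e - x e) <= s e by near: e.
  have h3 : forall i, `|y e 0 i - x e 0 i| <= rho e ^+ N.+1.
    by near: e; apply: filter_forall.
  have h4 : rho e <= (n.+1%:R)^-1 by near: e; apply: rho_le; rewrite invr_gt0.
  move: h1; rewrite ger0_norm ?subr_ge0// => h1.
  have h5 : enorm (v e - y e) <= enorm (v e - x e) + rho e ^+ N.+1 *+ n.
    apply: (le_trans (enorm_le_sum _ (v e - x e))); rewrite lerD2l.
    rewrite -[X in _ *+ X](card_ord n) -sumr_const; apply: ler_sum => i _; rewrite !mxE.
    by have := h3 i; rewrite -normrN; congr (`|_| <= _); ring.
  have h6 : rho e ^+ N.+1 *+ n.+1 <= rho e ^+ N.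
    rewrite exprS -mulrnAl ler_piMl ?(ltW (rho_gt0 rho N e))//.
    by rewrite -mulr_natr -ler_pdivlMr// mul1r.
  by move: h6; rewrite mulrS; lra.
split.
  apply: (represents_gle br sr); apply: filterS key => e he.
  by rewrite -subr_ge0 (le_trans _ he)// ltW// rho_gt0.
by apply: lb_invertible (representsB sr br) key.
Unshelve. all: by end_near. Qed.

(** A point of [U] lies in a finite intersection of subbasic balls inside [U], and the largest of
    their exponents serves them all. The exponent is fixed before [y], so one [m] covers every small
    displacement of [x]. *)
Lemma sharp_open_interior (U : set (gpoint rho n)) q x : open U -> U q ->
  vrepresents x q ->
  exists m, forall y q', vrepresents y q' ->
    (forall i, \forall e \near at0, `|y e 0 i - x e 0 i| <= rho e ^+ m) -> U q'.
Proof.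
move=> /sharp_openE[C CI <-] [A CA Aq] xq.
have [K KD KA] := CI _ CA; rewrite -KA in Aq.
have /choice[m Hm] : forall k, exists m, k \in K -> forall y q', vrepresents y q' ->
    (forall i, \forall e \near at0, `|y e 0 i - x e 0 i| <= rho e ^+ m) ->
    gball k.1 k.2 q'.
  (* The value 0 outside [K] only makes [m] total. *)
  move=> k; case: (boolP (k \in K)) => [kK|]; last by exists 0%N.
  by have [m H] := gball_interior (Aq k kK) xq; exists m.
exists (\max_(k <- K) m k)%N => y q' yq' xy; exists A => //; rewrite -KA => k kK.
apply: (Hm k kK y q' yq') => i; near=> e.
apply: (@le_trans _ _ (rho e ^+ (\max_(k <- K) m k)%N)); first by near: e; apply: xy.
by near: e; apply: rhoX_le; apply: leq_bigmax_seq.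
Unshelve. all: by end_near. Qed.
End SharpTopology.

(** * Independence of derivatives from the defining net *)

Section WellDefinedDerivatives.
Variables (R : realType) (rho : gauge R) (n d : nat).
Variable U : set (gpoint rho n).
Hypothesis U_open : open U.
Notation I := (netidx R).

(* If H_e = O(rho^k) at all points x + c delta_i with |c| <= rho^m, the mean
   value theorem with step rho^M gives D H_e = O(rho^(k - M)) somewhere within
   distance rho^M of x; moving back to x costs rho^M sup |D^2 H_e|. The sup is
   attained along a net that lies in U, so its order does not depend on M. *)
Lemma derive_negligible (i : 'I_n) (H : I -> 'rV[R]_n -> R) :
  (forall e y, derivable (H e) y (delta_mx 0 i)) ->
  (forall e y, derivable ('D_(delta_mx 0 i) (H e)) y (delta_mx 0 i)) ->
  (forall e, continuous ('D_(delta_mx 0 i) ('D_(delta_mx 0 i) (H e)))) ->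
  (forall (u : U) x, vrepresents x (val u) ->
     (fun e => H e (x e)) \in negligible rho) ->
  (forall (u : U) x, vrepresents x (val u) ->
     (fun e => 'D_(delta_mx 0 i) ('D_(delta_mx 0 i) (H e)) (x e))
       \in moderate rho) ->
  forall (u : U) x, vrepresents x (val u) ->
    (fun e => 'D_(delta_mx 0 i) (H e) (x e)) \in negligible rho.
Proof.
set v : 'rV[R]_n := delta_mx 0 i => dH d2H cH H0 H2 u x xu.
have [m Hm] := sharp_open_interior U_open (set_valP u) xu.
(* The hypotheses on [H] speak only of points of [U]; this lets them be applied along the segments
   through [x]. *)
have near_u (c : I -> R) : (\forall e \near at0, `|c e| <= rho e ^+ m) ->
    exists u' : U, vrepresents (fun e => x e + c e *: v) (val u').
  move=> cm; pose y e := x e + c e *: v.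
  have yE e j : y e 0 j - x e 0 j = c e * (j == i)%:R.
    by rewrite /y /v !mxE eqxx/= addrC addKr.
  have yx j : \forall e \near at0, `|y e 0 j - x e 0 j| <= rho e ^+ m.
    apply: filterS cm => e; apply: le_trans; rewrite yE normrM ler_piMr//.
    by case: eqP; rewrite ?normr1 ?normr0.
  have yr : vrepresents y (vclass rho y).
    move=> j; rewrite mxE; apply: represents_gclass.
    have [mx _] := xu j.
    rewrite (_ : (fun e => y e 0 j) =
      (fun e => x e 0 j) + (fun e => y e 0 j - x e 0 j)); last first.
      by apply/funext => e; rewrite -[RHS]/(x e 0 j + (y e 0 j - x e 0 j)) subrKC.
    apply: rpredD => //; apply: moderate_le (rhoX_moderate rho m) _.
    apply: filterS (yx j) => e /le_trans; apply; exact: ler_norm.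
  by exists (exist (fun p => p \in U) _ (mem_set (Hm y _ yr yx))).
have /choice[c Hc] : forall e, exists c : R, `|c| <= rho e ^+ m /\
    forall t : R, `|t| <= rho e ^+ m ->
    `|'D_v ('D_v (H e)) (x e + t *: v)| <= `|'D_v ('D_v (H e)) (x e + c *: v)|.
  move=> e; have r0 : 0 <= rho e ^+ m by exact/ltW/rho_gt0.
  have lr : - rho e ^+ m <= rho e ^+ m by rewrite (le_trans _ r0)// oppr_le0.
  have /(EVT_max lr)[c] : {within `[- rho e ^+ m, rho e ^+ m], continuous
      (fun t : R => `|'D_v ('D_v (H e)) (x e + t *: v)|)}.
    apply: continuous_subspaceT => t.
    apply: (@continuous_comp _ _ _
      (fun t : R => 'D_v ('D_v (H e)) (x e + t *: v)) Num.norm); last first.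
      exact: norm_continuous.
    apply: (@continuous_comp _ _ _
      (fun t : R => x e + t *: v) ('D_v ('D_v (H e)))); last first.
      exact: cH.
    by apply: cvgD; [exact: cvg_cst|exact: cvgZr_tmp].
  rewrite in_itv/= -ler_norml => hc Hc; exists c; split; first exact: hc.
  by move=> t ht; apply: Hc; rewrite in_itv/= -ler_norml.
have [|uc xuc] := near_u c; first by apply: nearW => e; have [] := Hc e.
have /moderateP[N [C C0 HC]] := H2 _ _ xuc.
apply/negligibleP => k.
(* [M >= m] keeps the step inside [U], and [M >= N + k] gives
   [rho e ^- N * rho e ^+ M <= rho e ^+ k] for small [e]. *)
pose M := (m + (N + k))%N.
have mM : (m <= M)%N by rewrite leq_addr.
have [|ut xut] := near_u (fun e => rho e ^+ M).
  apply: filterS (rhoX_le rho mM) => e.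
  by rewrite ger0_norm//; exact/ltW/rho_gt0.
(* The order [M + k] leaves [rho e ^+ k] after division by the step [rho e ^+ M]. *)
have /negligibleP/(_ (M + k)%N)[K K0 HK] := negligibleB (H0 _ _ xut) (H0 _ _ xu).
exists (K + C); first exact: addr_gt0.
near=> e.
have rM := rho_gt0 rho M e.
have [c1 hc1 E1] := MVT_line (x e) (rho e ^+ M) (dH e).
have [c2 hc2 E2] := MVT_line (x e) c1 (d2H e).
rewrite (ger0_norm (ltW rM)) in hc1.
have Mm : rho e ^+ M <= rho e ^+ m by near: e; exact: rhoX_le.
have b1 : `|'D_v (H e) (x e + c1 *: v)| <= K * rho e ^+ k.
  have : `|H e (x e + rho e ^+ M *: v) - H e (x e)| <= K * rho e ^+ (M + k).
    by near: e.
  by rewrite E1 normrM (gtr0_norm rM) exprD [leRHS]mulrA mulrAC ler_pM2r.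
have b2 : `|'D_v ('D_v (H e)) (x e + c2 *: v)| <= C * rho e ^- N.
  apply: (@le_trans _ _ `|'D_v ('D_v (H e)) (x e + c e *: v)|); last by near: e.
  by apply: (proj2 (Hc e)); apply: le_trans hc2 _; apply: le_trans hc1 _.
have b3 : rho e ^- N * `|c1| <= rho e ^+ k.
  rewrite mulrC ler_pdivrMr ?rho_gt0// -exprD addnC.
  by apply: le_trans hc1 _; near: e; apply: rhoX_le; rewrite leq_addl.
have -> : 'D_v (H e) (x e) = 'D_v (H e) (x e + c1 *: v) -
    'D_v ('D_v (H e)) (x e + c2 *: v) * c1 by rewrite -E2 subKr.
apply: (le_trans (ler_normB _ _)); rewrite mulrDl lerD// normrM.
apply: (@le_trans _ _ (C * rho e ^- N * `|c1|)); first by rewrite ler_wpM2r.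
by rewrite -mulrA ler_pM2l.
Unshelve. all: by end_near. Qed.

(** [MU] controls multi-indices only; by symmetry of mixed partials a word of derivatives depends
    just on its letter counts. *)
Lemma moderate_iter_partial (f : MU d U) (s : seq 'I_n) (u : U) x :
  vrepresents x (val u) ->
  vmoderate rho (fun e => iter_partial s (sval f e) (x e)).
Proof.
move=> xu j; have [sf mf] := svalP f.
pose a := [ffun i => count_mem i s].
have E e : iter_partial s (sval f e) = pderiv a (sval f e).
  rewrite pderivE; apply: iter_partial_perm => //.
  by apply/allP => i _ /=; rewrite count_word ffunE.
rewrite (_ : (fun e => _) = fun e => pderiv a (sval f e) (x e) 0 j).
  exact: mf xu a j.
by apply/funext => e; rewrite E.
Qed.

(** Words make each induction step a single partial derivative. The point and its representative
    stay general because [derive_negligible] uses the previous order at displaced points as well. *)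
Lemma iter_partial_negligible (f g : MU d U) :
  pi_net [ffun=> 0%N] f = pi_net [ffun=> 0%N] g ->
  forall s (u : U) x j, vrepresents x (val u) ->
  (fun e => iter_partial s (sval f e) (x e) 0 j) -
  (fun e => iter_partial s (sval g e) (x e) 0 j) \in negligible rho.
Proof.
move=> fg; have [sf mf] := svalP f; have [sg mg] := svalP g.
elim=> [|i s IH] u x j xu.
  (* [pi_net] evaluates at [vrepr] only; [moderate_net_repr] carries the equality to the
     representative [x]. *)
  apply/eq_gclass; try exact: (moderate_iter_partial _ [::] xu).
  have vu := vrepr_represents (val u).
  have Ef := moderate_net_repr (svalP f) xu vu.
  have Eg := moderate_net_repr (svalP g) xu vu.
  have pi0 (h : MU d U) : pi_net [ffun=> 0%N] h u =
      vclass rho (fun e => sval h e (vrepr (val u) e)).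
    by congr vclass; apply/funext => e; rewrite pderiv0.
  have /rowP/(_ j) : vclass rho (fun e => sval f e (x e)) =
      vclass rho (fun e => sval g e (x e)) by rewrite Ef Eg -!pi0 fg.
  by rewrite !mxE.
pose H e (y : 'rV[R]_n) : R :=
  iter_partial s (sval f e) y 0 j - iter_partial s (sval g e) y 0 j.
have dP h t e k (y : 'rV[R]_n) : (forall e, smooth (h e)) ->
    derivable (fun y => iter_partial t (h e) y 0 j : R) y (delta_mx 0 k).
  by move=> sh; apply: coord_derivable; have [_] := sh e t; apply.
have DP h t e k (y : 'rV[R]_n) : (forall e, smooth (h e)) ->
    'D_(delta_mx 0 k) (fun y => iter_partial t (h e) y 0 j : R) y =
    iter_partial (k :: t) (h e) y 0 j.
  by move=> sh; apply: coord_derive; have [_] := sh e t; apply.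
have DB t e : 'D_(delta_mx 0 i) (fun y => iter_partial t (sval f e) y 0 j -
      iter_partial t (sval g e) y 0 j : R) = fun y =>
    iter_partial (i :: t) (sval f e) y 0 j - iter_partial (i :: t) (sval g e) y 0 j.
  by apply/funext => y; rewrite deriveB; [rewrite !DP|exact: dP|exact: dP].
have DH e := DB s e : 'D_(delta_mx 0 i) (H e) = _.
have D2H e : 'D_(delta_mx 0 i) ('D_(delta_mx 0 i) (H e)) = fun y =>
    iter_partial [:: i, i & s] (sval f e) y 0 j -
    iter_partial [:: i, i & s] (sval g e) y 0 j.
  by rewrite DH; exact: DB.
rewrite (_ : _ - _ = fun e => 'D_(delta_mx 0 i) (H e) (x e)); last first.
  by apply/funext => e; exact: (esym (congr1 (@^~ (x e)) (DH e))).
apply: (@derive_negligible i H) xu.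
- by move=> e y; apply: derivableB; exact: dP.
- by move=> e y; rewrite DH; apply: derivableB; exact: dP.
- move=> e; rewrite D2H.
  have cP (h : 'rV[R]_n -> 'rV[R]_d) t :
      smooth h -> continuous (fun y => iter_partial t h y 0 j : R).
    move=> sh z; apply: (@continuous_comp _ _ _ (iter_partial t h)
      (fun M : 'rV[R]_d => M 0 j)).
      by have [+ _] := sh t; apply.
    exact: coord_continuous.
  have cB (F1 F2 : 'rV[R]_n -> R) : continuous F1 -> continuous F2 ->
      continuous (fun y => F1 y - F2 y).
    by move=> c1 c2 y; exact: cvgB (c1 y) (c2 y).
  exact: cB (cP _ _ (sf e)) (cP _ _ (sg e)).
- by move=> u' x' xu'; exact: IH xu'.
- move=> u' x' xu'; pose t := [:: i, i & s].
  rewrite (_ : (fun e => _) = (fun e => iter_partial t (sval f e) (x' e) 0 j) -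
      (fun e => iter_partial t (sval g e) (x' e) 0 j)).
    by apply: rpredB; exact: moderate_iter_partial xu' _.
  by apply/funext => e; exact: (congr1 (@^~ (x' e)) (D2H e)).
Qed.

Lemma pi_net_eq (f g : MU d U) : pi_net [ffun=> 0%N] f = pi_net [ffun=> 0%N] g ->
  forall a, pi_net a f = pi_net a g.
Proof.
move=> fg a; apply/funext => u; apply/rowP => j; rewrite !mxE.
have vu := vrepr_represents (val u).
apply/eq_gclass; first by have [_ /(_ u _ vu a)] := svalP f; apply.
  by have [_ /(_ u _ vu a)] := svalP g; apply.
have := iter_partial_negligible fg (word a) j vu.
by under eq_fun do rewrite -pderivE; under [X in _ - X]eq_fun do rewrite -pderivE.
Qed.

Lemma pi_net0 (f : MU d U) : pi_net [ffun=> 0%N] f = sval (gsf f).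
Proof.
by apply/funext => u; congr vclass; apply/funext => e; rewrite pderiv0.
Qed.

Lemma gsf_defining_net (F : GC d U) : gsf (defining_net F) = F.
Proof.
apply: eq_sig_hprop => [? ? ?|]; first exact: Prop_irrelevance.
apply/funext => u; rewrite /= /defining_net /=.
case: (cid _) => f [sf Hf] /=.
by have [-> _] := Hf u _ (vrepr_represents (val u)).
Qed.

(** The net chosen by [defining_net] and [f] define the same function, so they agree at order 0 and
    hence at every order. *)
Lemma gderiv_gsf a (f : MU d U) : sval (gderiv a (gsf f)) = pi_net a f.
Proof.
rewrite -(@pi_net_eq (defining_net (gsf f)) f)//.
by rewrite !pi_net0 gsf_defining_net.
Qed.
End WellDefinedDerivatives.

(** * The universal map out of [G] *)

Theorem theorem31 (R : realType) (rho : gauge R) (n d : nat)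
    (U : set (gpoint rho n)) (U_open : open U)
    (G : set (U -> gpoint rho d))
    (q : MU d U -> G) (q_surj : forall F : G, exists f : MU d U, q f = F)
    (D : {ffun 'I_n -> nat} -> G -> (U -> gpoint rho d))
    (D0 : forall F : G, D [ffun=> 0%N] F = sval F)
    (Dq : forall (a : {ffun 'I_n -> nat}) (f : MU d U), D a (q f) = pi_net a f) :
  exists! phi : G -> GC d U,
    (forall f : MU d U, phi (q f) = gsf f) /\
    (forall (F : G) (a : {ffun 'I_n -> nat}), sval (gderiv a (phi F)) = D a F).
Proof.
have /choice[net qnet] := q_surj.
(* The section [net] of [q] is arbitrary, but [D [ffun=> 0%N]] recovers the function [gsf f] from
   [q f]. *)
have phiq f : gsf (net (q f)) = gsf f.
  apply: eq_sig_hprop => [? ? ?|]; first exact: Prop_irrelevance.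
  by rewrite -!pi_net0 -!Dq qnet.
exists (fun F => gsf (net F)); split.
  by split=> // F a; rewrite gderiv_gsf// -Dq qnet.
(* Each [F] equals [q (net F)], where compatibility with [q] prescribes the value of [psi]. *)
move=> psi [psiq _]; apply/funext => F.
by rewrite -psiq qnet.
Qed.
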